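(* For any given graph $G$, $\mathrm{boxicity}(G^{\times d})$, as a function of $d$, is in $O(d)$; and there exist graphs $G$ for which it is in $\Omega(d)$.
   Context: All graphs are finite, undirected and simple. A $k$-box is a Cartesian product of $k$ closed intervals of $\mathbb{R}$. The boxicity of a graph $G$ is the smallest natural number $k$ (with $0$ allowed; complete graphs have boxicity $0$) such that there is a function $f$ mapping each vertex of $G$ to a $k$-box so that any two distinct vertices $u,v$ are adjacent in $G$ iff $f(u)\cap f(v)\neq\emptyset$. The direct product $G_1\times G_2$ is the graph on $V(G_1)\times V(G_2)$ in which $(u_1,u_2)$ and $(v_1,v_2)$ are adjacent iff $u_1v_1\in E(G_1)$ and $u_2v_2\in E(G_2)$. $G^{\times d}$ is the direct product of $d$ copies of $G$. The graph $G$ is fixed and asymptotics are as $d\to\infty$; implied constants may depend on $G$. *)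

(* Defs.v *)
From mathcomp Require Import all_boot all_order all_algebra.
From mathcomp Require Import all_classical all_reals all_analysis.

Set Implicit Arguments.
Unset Strict Implicit.
Unset Printing Implicit Defensive.
Import Order.TTheory GRing.Theory Num.Theory.
Import numFieldNormedType.Exports.

Local Open Scope classical_set_scope.
Local Open Scope ring_scope.

Record sgraph := SGraph {
  vertex :> finType;
  adj : rel vertex;
  adj_sym : symmetric adj;
  adj_irrefl : irreflexive adj
}.

Section DirectProduct.
Variables G1 G2 : sgraph.

Definition direct_adj : rel (G1 * G2)%type :=
  fun u v => adj u.1 v.1 && adj u.2 v.2.

Lemma direct_adj_sym : symmetric direct_adj.
Proof. by move=> u v; rewrite /direct_adj adj_sym [X in _ && X]adj_sym. Qed.

Lemma direct_adj_irrefl : irreflexive direct_adj.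
Proof. by move=> u; rewrite /direct_adj adj_irrefl. Qed.

Definition direct_product : sgraph :=
  @SGraph (G1 * G2)%type direct_adj direct_adj_sym direct_adj_irrefl.
End DirectProduct.

(* The direct product of d copies of G, for d >= 1. The empty product would be
   a vertex with a loop, which is not a simple graph; d = 0 gives G itself. *)
Definition direct_power (G : sgraph) (d : nat) : sgraph :=
  iter d.-1 (fun H => direct_product H G) G.

Section Boxicity.
Variable R : realType.

(* The unique 0-box is the one-point space 'rV[R]_0. *)
Definition is_box (k : nat) (B : set 'rV[R]_k) : Prop :=
  exists l u : 'rV[R]_k, (forall i, l 0 i <= u 0 i) /\
    B = [set x | forall i, x 0 i \in `[l 0 i, u 0 i]].

Definition box_representation (G : sgraph) (k : nat)
    (f : G -> set 'rV[R]_k) : Prop :=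
  (forall v, is_box (f v)) /\
  (forall u v, u != v -> (adj u v <-> f u `&` f v !=set0)).

Definition box_representable (G : sgraph) (k : nat) : Prop :=
  exists f : G -> set 'rV[R]_k, box_representation f.

(* One dimension for each vertex a, in which a is sent to [0, 0], its
   neighbours to [0, 1] and every other vertex to [1, 1]. *)
Lemma box_representable_card (G : sgraph) : box_representable G #|G|.
Proof.
pose lo (v : G) : 'rV[R]_#|G| := \row_i
  (if (v == enum_val i) || adj v (enum_val i) then 0 else 1).
pose hi (v : G) : 'rV[R]_#|G| := \row_i (if v == enum_val i then 0 else 1).
exists (fun v => [set x | forall i, x 0 i \in `[lo v 0 i, hi v 0 i]]); split.
  move=> v; exists (lo v), (hi v); split=> // i; rewrite !mxE.
  by case: eqVneq => //= _; case: ifP.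
move=> u v uv; split=> [auv|[x [/= xu xv]]].
  exists (\row_i (if (u == enum_val i) || (v == enum_val i) then 0 else 1)).
  split=> i /=; rewrite in_itv /= !mxE.
    case: eqVneq => [_|ui] /=; first by rewrite lexx.
    by case: (eqVneq v) => [<-|_]; rewrite ?auv ?lexx ?ler01 //=; case: ifP;
      rewrite ?lexx ?ler01.
  case: (eqVneq v) => [_|vi] /=; first by rewrite orbT lexx.
  rewrite orbF; case: (eqVneq u) => [<-|_]; rewrite 1?adj_sym ?auv ?lexx ?ler01 //=.
  by case: ifP; rewrite ?lexx ?ler01.
apply/negPn/negP => nuv.
have := xu (enum_rank u); have := xv (enum_rank u).
rewrite !in_itv /= !mxE enum_rankK eqxx /= eq_sym (negbTE uv) /= adj_sym.
rewrite (negbTE nuv) => /andP[x1 _] /andP[_ x0].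
by have := le_trans x1 x0; rewrite ler10.
Qed.

Lemma box_representable_ex (G : sgraph) : exists k, `[< box_representable G k >].
Proof. by exists #|G|; apply/asboolP; exact: box_representable_card. Qed.

Definition boxicity (G : sgraph) : nat := ex_minn (box_representable_ex G).

End Boxicity.

(* Main.v *)
Require Import Defs.
From mathcomp Require Import all_boot all_order all_algebra.
From mathcomp Require Import all_classical all_reals all_analysis.
Import Order.TTheory GRing.Theory Num.Theory.
Import numFieldNormedType.Exports.
Local Open Scope classical_set_scope.
Local Open Scope ring_scope.

(** Upper bound: fix a coordinate [i] and a vertex [a] of [G]. Send the vertices
    with [i]-th coordinate [a] to distinct points of [[0, M)], those whose
    [i]-th coordinate is adjacent to [a] to [[0, M]], and all others to
    [[M, M]]. This is an interval supergraph of the power, and every non-edge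
    [u v] is missing in one of these [d * #|G|] graphs: take [i] with
    [u_i], [v_i] not adjacent and [a = v_i].

    Lower bound: in the [d]-th power of the triangle [{0, 1, 2}], let [a_i] have
    [0] at position [i] and [1] elsewhere, and let [b_j] have [0] at position
    [j] and [2] elsewhere. Then [a_i] and [b_j] are adjacent iff [i != j]. In a
    box representation each [a_i] is separated from [b_i] along some axis with
    one of two orientations, and no two indices share axis and orientation.
    Hence the boxicity is at least [d / 2] for [d >= 2]; for [d = 1] the
    vertices [a_i] and [b_i] coincide. *)

(** Two boxes meet iff their intervals overlap on every axis; the larger of the two lower ends is
    then a common coordinate. *)
Lemma box_representableP (R : realType) (G : sgraph) (k : nat) :
  box_representable R G k <->
  exists lo hi : G -> 'I_k -> R, (forall v i, lo v i <= hi v i) /\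
    forall u v, u != v ->
      adj u v = [forall i, (lo u i <= hi v i) && (lo v i <= hi u i)].
Proof.
split=> [[f [fbox fadj]]|[lo [hi [lohi loadj]]]].
  have /choice[l /choice[h lhP]] : forall v, exists l h : 'rV[R]_k,
      (forall i, l 0 i <= h 0 i) /\
      f v = [set x | forall i, x 0 i \in `[l 0 i, h 0 i]].
    by move=> v; exact: fbox.
  exists (fun v => l v 0), (fun v => h v 0).
  split=> [v i|u v uv]; first by case: (lhP v).
  have [lhu fu] := lhP u; have [lhv fv] := lhP v.
  apply/idP/forallP => [/(fadj _ _ uv)[x []]|meet].
    rewrite fu fv /= => xu xv i.
    have := xu i; have := xv i; rewrite !in_itv /=.
    by move=> /andP[a b] /andP[c e]; rewrite (le_trans c b) (le_trans a e).
  apply/(fadj _ _ uv); exists (\row_i Num.max (l u 0 i) (l v 0 i)).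
  rewrite fu fv; split=> i /=; have /andP[a b] := meet i.
    by rewrite mxE in_itv /= le_max lexx /= ge_max lhu.
  by rewrite mxE in_itv /= le_max lexx orbT /= ge_max lhv a.
exists (fun v => [set x | forall i, x 0 i \in `[lo v i, hi v i]]).
split=> [v|u v uv].
  exists (\row_i lo v i), (\row_i hi v i); split=> [i|]; first by rewrite !mxE.
  by apply/seteqP; split=> x /= + i => /(_ i); rewrite !mxE.
rewrite loadj //; split=> [/forallP meet|[x [/= xu xv]]].
  exists (\row_i Num.max (lo u i) (lo v i)).
  split=> i /=; have /andP[a b] := meet i.
    by rewrite mxE in_itv /= le_max lexx /= ge_max lohi.
  by rewrite mxE in_itv /= le_max lexx orbT /= ge_max lohi a.
apply/forallP => i; have := xu i; have := xv i; rewrite !in_itv /=.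
by move=> /andP[a b] /andP[c e]; rewrite (le_trans c b) (le_trans a e).
Qed.

Lemma boxicity_leq (R : realType) (G : sgraph) (k : nat) :
  box_representable R G k -> (boxicity R G <= k)%N.
Proof.
by move=> Gk; rewrite /boxicity; case: ex_minnP => m _; apply; apply/asboolP.
Qed.

Lemma box_representable_boxicity (R : realType) (G : sgraph) :
  box_representable R G (boxicity R G).
Proof. by rewrite /boxicity; case: ex_minnP => m /asboolP. Qed.

(** Gives the iterated pairs a flat view: [phi i] reads coordinate [i], and any sequence of
    coordinates is realised by a vertex. *)
Lemma direct_power_coord (G : sgraph) (n : nat) :
  exists phi : nat -> direct_power G n.+1 -> G,
    (forall u v, adj u v <->
      forall i, (i <= n)%N -> adj (phi i u) (phi i v)) /\
    (forall f : nat -> G, exists x, forall i, (i <= n)%N -> phi i x = f i).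
Proof.
elim: n => [|n [phi [phi_adj phi_surj]]].
  exists (fun _ => id); split=> [u v|f].
    by split=> [uv i|/(_ 0%N)/(_ (leqnn 0))].
  by exists (f 0%N) => i; rewrite leqn0 => /eqP->.
exists (fun i u => if i == n.+1 then u.2 else phi i u.1); split=> [u v|f].
  split=> [/andP[/phi_adj adj1 adj2] i|adj_i].
    by rewrite leq_eqVlt ltnS; case: eqVneq => //= _; exact: adj1.
  apply/andP; split; last by have := adj_i n.+1 (leqnn _); rewrite eqxx.
  apply/phi_adj => i le_in; have := adj_i i (leqW le_in).
  by rewrite ltn_eqF.
have [x xf] := phi_surj f; exists (x, f n.+1) => i.
by rewrite leq_eqVlt ltnS; case: eqVneq => [->//|_] /=; exact: xf.
Qed.

Lemma boxicity_coord (R : realType) (G H : sgraph) (n : nat)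
    (phi : nat -> H -> G) :
  (forall u v, adj u v <-> forall i, (i < n)%N -> adj (phi i u) (phi i v)) ->
  (boxicity R H <= n * #|G|)%N.
Proof.
move=> phi_adj.
have -> : (n * #|G|)%N = #|{: 'I_n * G}| by rewrite card_prod card_ord.
apply/boxicity_leq/box_representableP.
(* The ranks are the distinct points, and [#|H|] serves as [M]. *)
pose t (u : H) : nat := enum_rank u.
have t_lt u : (t u < #|H|)%N by exact: ltn_ord.
pose lo (u : H) (p : 'I_n * G) : nat :=
  if phi p.1 u == p.2 then t u else if adj (phi p.1 u) p.2 then 0%N else #|H|.
pose hi (u : H) (p : 'I_n * G) : nat := if phi p.1 u == p.2 then t u else #|H|.
have lo_le u p : (lo u p <= #|H|)%N.
  by rewrite /lo; case: ifP => _; [exact: ltnW | case: ifP].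
exists (fun u j => (lo u (enum_val j))%:R), (fun u j => (hi u (enum_val j))%:R).
split=> [u j|u v uv].
  by rewrite ler_nat /lo /hi; case: ifP => // _; case: ifP.
(* If [hi v' p] is not [M], then [v'] has the vertex [p.2] at position [p.1]; its neighbour [u']
   then starts at 0. *)
have edge_le u' v' p : adj u' v' -> (lo u' p <= hi v' p)%N.
  move=> /phi_adj/(_ p.1 (ltn_ord _)) Guv; rewrite /hi.
  case: eqVneq => [v'p|_]; last exact: lo_le.
  by move: Guv; rewrite /lo v'p; case: eqVneq => [->|_ ->//]; rewrite adj_irrefl.
apply/idP/forallP => [Huv j|meet].
  by rewrite !ler_nat !edge_le // adj_sym.
apply/phi_adj => i i_n; apply/negPn/negP => nGuv.
(* Here [v] is the point [t v], while [u] is either another point or [[M, M]]. *)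
have := meet (enum_rank (Ordinal i_n, phi i v)).
rewrite enum_rankK !ler_nat /lo /hi /= eqxx (negPf nGuv).
case: ifP => _; last by rewrite leqNgt t_lt.
by rewrite -eqn_leq => /eqP/ord_inj/enum_rank_inj/eqP; rewrite (negPf uv).
Qed.

Lemma boxicity_direct_power_le (R : realType) (G : sgraph) (n : nat) :
  (boxicity R (direct_power G n.+1) <= n.+1 * #|G|)%N.
Proof.
have [phi [phi_adj _]] := direct_power_coord G n.
exact: (boxicity_coord R G _ n.+1 phi).
Qed.

(** If [i != j] shared axis and orientation, the edges [a i, b j] and [a j, b i] would close a cycle
    such as [lo (a i) <= hi (b j) < lo (a j) <= hi (b i) < lo (a i)]. *)
Lemma boxicity_crown (R : realType) (H : sgraph) (n : nat) (a b : 'I_n -> H) :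
  (forall i, a i != b i) -> (forall i j, adj (a i) (b j) = (i != j)) ->
  (n <= 2 * boxicity R H)%N.
Proof.
move=> aibi_neq ab_adj.
have ab_neq i j : a i != b j.
  have [->//|neq_ij] := eqVneq i j.
  by apply/eqP => eq_ab; have := ab_adj i j; rewrite eq_ab adj_irrefl neq_ij.
have /box_representableP[lo [hi [_ lohi_adj]]] := box_representable_boxicity R H.
have /choice[s sP] : forall i, exists s : bool * 'I_(boxicity R H),
    if s.1 then hi (b i) s.2 < lo (a i) s.2 else hi (a i) s.2 < lo (b i) s.2.
  move=> i; have := lohi_adj _ _ (ab_neq i i); rewrite ab_adj eqxx /=.
  move=> /esym/negbT/forallPn[j]; rewrite negb_and -!ltNge.
  by case/orP => lt_hi; [exists (true, j) | exists (false, j)].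
have s_inj : injective s.
  move=> i j eq_s; apply/eqP/negPn/negP => neq_ij.
  have := lohi_adj _ _ (ab_neq i j); rewrite ab_adj neq_ij.
  move=> /esym/forallP/(_ (s i).2)/andP[ij1 ij2].
  have := lohi_adj _ _ (ab_neq j i); rewrite ab_adj eq_sym neq_ij.
  move=> /esym/forallP/(_ (s i).2)/andP[ji1 ji2].
  have := sP i; have := sP j; rewrite -eq_s; case: ifP => _ ltj lti.
    have := lt_trans (le_lt_trans ji1 lti) (le_lt_trans ij1 ltj).
    by rewrite ltxx.
  have := lt_trans (le_lt_trans ij2 lti) (le_lt_trans ji2 ltj).
  by rewrite ltxx.
by have := leq_card s s_inj; rewrite card_prod card_bool !card_ord.
Qed.

Lemma neq_sym (T : eqType) : symmetric (fun x y : T => x != y).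
Proof. by move=> x y; rewrite eq_sym. Qed.

Lemma neq_irrefl (T : eqType) : irreflexive (fun x y : T => x != y).
Proof. by move=> x; rewrite eqxx. Qed.

Definition triangle : sgraph :=
  SGraph (neq_sym 'I_3) (neq_irrefl 'I_3).

Lemma boxicity_triangle_power (R : realType) (n : nat) :
  (n.+2 <= 2 * boxicity R (direct_power triangle n.+2))%N.
Proof.
have [phi [phi_adj phi_surj]] := direct_power_coord triangle n.+1.
have vertexP (c : 'I_3) : forall i : 'I_n.+2, exists x, forall k, (k <= n.+1)%N ->
    phi k x = if k == i then ord0 else c.
  by move=> i; exact: (phi_surj (fun k => if k == i then ord0 else c)).
pose c1 : 'I_3 := Ordinal (isT : (1 < 3)%N).
pose c2 : 'I_3 := Ordinal (isT : (2 < 3)%N).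
have /choice[a aP] := vertexP c1; have /choice[b bP] := vertexP c2.
have ab_adj i j : adj (a i) (b j) = (i != j).
  have i_n : (i <= n.+1)%N by rewrite -ltnS.
  apply/idP/idP => [/phi_adj/(_ i i_n)|neq_ij].
    by case: eqVneq => // <-; rewrite aP // bP // eqxx.
  apply/phi_adj => k k_n; rewrite aP // bP //.
  have [->|_] := eqVneq k i; last by case: ifP.
  by rewrite (inj_eq val_inj) (negPf neq_ij).
apply: (boxicity_crown R _ _ a b) => // i.
(* With at least two positions, some [k] differs from [i]; there [a i] has 1 and [b i] has 2. *)
have [k k_n neq_ki] : exists2 k, (k <= n.+1)%N & k != i :> nat.
  by case: i => -[|i] ?; [exists 1%N | exists 0%N].
apply/eqP => /(congr1 (phi k)); rewrite aP // bP // (negPf neq_ki).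
by move/(congr1 val).
Qed.

Theorem corollary11 (R : realType) :
  (forall G : sgraph,
     (fun d : nat => (boxicity R (direct_power G d))%:R : R^o)
       =O_\oo (fun d : nat => d%:R : R^o)) /\
  (exists G : sgraph,
     (fun d : nat => (boxicity R (direct_power G d))%:R : R^o)
       =Omega_\oo (fun d : nat => d%:R : R^o)).
Proof.
split=> [G|].
  (* The [+ 1] keeps the constant positive when [G] has no vertices. *)
  apply/eqO_exP; exists (#|G|%:R + 1); first by rewrite ltr_wpDl.
  exists 1%N => // -[//|n] _; rewrite !normr_nat.
  rewrite (le_trans (y := (n.+1 * #|G|)%:R)) ?ler_nat ?boxicity_direct_power_le //.
  by rewrite natrM mulrC ler_pM2r ?ltr0n // lerDl.
exists triangle; rewrite eqOmegaE eqOmegaO; apply/eqO_exP; exists 2 => //.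
(* At [d = 1] the bound fails: the triangle is complete and has boxicity 0. *)
exists 2%N => // -[//|[//|n]] _; rewrite !normr_nat -natrM ler_nat.
exact: boxicity_triangle_power.
Qed.
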